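(* Let $U\subset\mathbb{R}^n$ be a domain with $\mathbb{R}^{>0}\cdot U\subset U$ and $h:U\to\mathbb{R}$ a smooth positive function, homogeneous of degree $k>1$, such that $-\partial^2h$ restricts to a positive definite metric on $\{h=1\}$. Assume that the Riemannian metric $g'=-\partial^2\log h$ on $U$ is complete, and let $c<0$. Then the Riemannian metric $g'_c=-\partial^2\log(h+c)$ on $U_c=\{x\in U\mid h(x)+c>0\}$ is complete.
   Context: $\partial^2$ denotes the real Hessian with respect to the standard linear coordinates of $\mathbb{R}^n$. (That $g'$ and $g'_c$ are Riemannian on $U$ and $U_c$ respectively is known in this setting.) *)

(* Defs.v *)
From Stdlib Require Import Reals.
From mathcomp Require Import ssreflect ssrfun ssrbool eqtype ssrnat seq fintype bigop.
Set Implicit Arguments. Unset Strict Implicit.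
Open Scope R_scope.

Definition vec (n : nat) := 'I_n -> R.
Definition vadd {n} (x y : vec n) : vec n := fun i => x i + y i.
Definition vscal {n} (t : R) (x : vec n) : vec n := fun i => t * x i.
Definition vzero {n} : vec n := fun _ => 0.
Definition vbasis {n} (i : 'I_n) : vec n := fun j => if j == i then 1 else 0.
Definition vnorm {n} (x : vec n) : R := sqrt (\big[Rplus/0]_(i < n) (x i * x i)).
Definition vdist {n} (x y : vec n) : R := vnorm (vadd x (vscal (-1) y)).

Definition is_open {n} (U : vec n -> Prop) : Prop :=
  forall x, U x -> exists r, 0 < r /\ forall y, vdist y x < r -> U y.
Definition is_connected {n} (U : vec n -> Prop) : Prop :=
  forall V W : vec n -> Prop, is_open V -> is_open W ->
    (forall x, U x -> V x \/ W x) -> (forall x, ~ (U x /\ V x /\ W x)) ->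
    (exists x, U x /\ V x) -> (exists x, U x /\ W x) -> False.
Definition is_domain {n} (U : vec n -> Prop) : Prop :=
  is_open U /\ is_connected U /\ exists x, U x.

Definition continuous_in {n} (U : vec n -> Prop) (g : vec n -> R) (x : vec n) : Prop :=
  forall eps, 0 < eps -> exists delta, 0 < delta /\
    forall y, U y -> vdist y x < delta -> Rabs (g y - g x) < eps.

Definition smooth_on {n} (U : vec n -> Prop) (f : vec n -> R) : Prop :=
  exists D : seq 'I_n -> vec n -> R,
    (forall x, U x -> D [::] x = f x) /\
    (forall s i x, U x ->
       derivable_pt_lim (fun t => D s (vadd x (vscal t (vbasis i)))) 0 (D (i :: s) x)) /\
    (forall s x, U x -> continuous_in U (D s) x).

Definition dderiv {n} (f : vec n -> R) (x v : vec n) (l : R) : Prop :=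
  derivable_pt_lim (fun t => f (vadd x (vscal t v))) 0 l.

Definition dderiv2 {n} (f : vec n -> R) (x v : vec n) (l : R) : Prop :=
  exists (d : R -> R) (delta : R), 0 < delta /\
    (forall t, Rabs t < delta ->
       derivable_pt_lim (fun s => f (vadd x (vscal s v))) t (d t)) /\
    derivable_pt_lim d 0 l.

(* Riemannian metric g = - d^2 phi (Hessian metric).  [short_path U phi x y eps]:
   there is a C^1 curve in U from x to y whose g-length is < eps. *)
Definition short_path {n} (U : vec n -> Prop) (phi : vec n -> R) (x y : vec n) (eps : R)
  : Prop :=
  exists (gam dgam : R -> vec n) (q : R -> R),
    gam 0 = x /\ gam 1 = y /\
    (forall t, 0 <= t <= 1 -> U (gam t)) /\
    (forall t i, 0 <= t <= 1 -> derivable_pt_lim (fun s => gam s i) t (dgam t i)) /\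
    (forall t i, 0 <= t <= 1 -> continuity_pt (fun s => dgam s i) t) /\
    (forall t, 0 <= t <= 1 -> dderiv2 phi (gam t) (dgam t) (q t)) /\
    exists pr : Riemann_integrable (fun t => sqrt (- q t)) 0 1, RiemannInt pr < eps.

(* Metric completeness of (U, d_g), where d_g(x,y) < eps iff short_path U phi x y eps. *)
Definition hessian_metric_complete {n} (U : vec n -> Prop) (phi : vec n -> R) : Prop :=
  forall u : nat -> vec n, (forall m, U (u m)) ->
    (forall eps, 0 < eps -> exists N : nat, forall m k : nat,
        (N <= m)%nat -> (N <= k)%nat -> short_path U phi (u m) (u k) eps) ->
    exists p, U p /\ forall eps, 0 < eps -> exists N : nat, forall m : nat,
        (N <= m)%nat -> short_path U phi (u m) p eps.

(* Main.v *)
(** Write [P] and [Q] for the first and second directional derivatives of [h] at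
    [x] along [v].  Splitting [v] into a radial part and a part tangent to the level
    set of [h], homogeneity and the definiteness assumption give
    [Q <= (k - 1) / k * P^2 / h].  From this inequality alone one gets, for [c <= 0]:
    - [g'_c >= g'], so a [g'_c]-Cauchy sequence [u] is [g']-Cauchy and has a [g']-limit [p];
    - [ln (h + c)] is [sqrt k]-Lipschitz for [g'_c], so [h + c] is bounded away from [0] on [u],
      and [ln h] is [sqrt k]-Lipschitz for [g'], so the same holds, with half the bound, all
      along short [g']-curves from [u m] to [p];
    - where [h >= m > -c], [g'_c <= k (m / (m + c))^2 g'], so these curves are also
      [g'_c]-short. *)

Require Import Defs.
From Stdlib Require Import Reals Lra Classical FunctionalExtensionality.
From Coquelicot Require Import Coquelicot.
From HB Require Import structures.
From mathcomp Require Import ssreflect ssrfun ssrbool eqtype ssrnat seq fintype bigop.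
Set Implicit Arguments. Unset Strict Implicit.
Open Scope R_scope.

(** * Finite sums of reals, the dot product and the Euclidean norm *)

Lemma RplusA : associative Rplus.
Proof. by move=> x y z; rewrite Rplus_assoc. Qed.

HB.instance Definition _ :=
  Monoid.isComLaw.Build R 0 Rplus RplusA Rplus_comm Rplus_0_l.

Notation Rsum n F := (\big[Rplus/0]_(i < n) F i).

Definition dot {n} (a v : vec n) : R := Rsum n (fun i => a i * v i).

Lemma Rsum_le n (F G : 'I_n -> R) :
  (forall i, F i <= G i) -> Rsum n F <= Rsum n G.
Proof. by move=> FG; elim/big_ind2: _ => // *; lra. Qed.

Lemma Rsum_abs n (F : 'I_n -> R) : Rabs (Rsum n F) <= Rsum n (fun i => Rabs (F i)).
Proof.
elim/big_ind2: _ => [|x1 x2 y1 y2 ? ?|i _]; last exact: Rle_refl.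
  by rewrite Rabs_R0; lra.
by move: (Rabs_triang x2 y2); lra.
Qed.

Lemma Rsum_scal n t (F : 'I_n -> R) : Rsum n (fun i => t * F i) = t * Rsum n F.
Proof. by apply: esym; elim/big_rec2: _ => [|i y1 y2 _ <-]; lra. Qed.

Lemma Rsum_ge0 n (F : 'I_n -> R) : (forall i, 0 <= F i) -> 0 <= Rsum n F.
Proof. by move=> F0; elim/big_ind: _ => // *; lra. Qed.

Lemma Rsum_telescope n (g : nat -> R) :
  Rsum n (fun i : 'I_n => g i.+1 - g i) = g n - g 0%N.
Proof. by elim: n => [|n IH]; rewrite ?big_ord0 ?big_ord_recr /= ?IH; lra. Qed.

Lemma Rsum_is_derive n (F : 'I_n -> R -> R) (dF : 'I_n -> R) t :
  (forall i, is_derive (F i) t (dF i)) ->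
  is_derive (fun s => Rsum n (fun i => F i s)) t (Rsum n dF).
Proof.
elim: n F dF => [|n IH] F dF hF.
  rewrite big_ord0; apply: (is_derive_ext (fun=> 0)) => [s|]; first by rewrite big_ord0.
  exact: is_derive_const.
rewrite big_ord_recl.
apply: (is_derive_ext (fun s => plus (F ord0 s) (Rsum n (fun i => F (lift ord0 i) s)))).
  by move=> s; rewrite big_ord_recl.
by apply: is_derive_plus => //; apply: IH.
Qed.

Lemma Rsum_continuity n (F : 'I_n -> R -> R) t :
  (forall i, continuity_pt (F i) t) ->
  continuity_pt (fun s => Rsum n (fun i => F i s)) t.
Proof.
elim: n F => [|n IH] F hF.
  apply: (continuity_pt_ext (fun=> 0)) => [s|]; first by rewrite big_ord0.
  exact: continuity_pt_const.
apply: (continuity_pt_ext (fun s => F ord0 s + Rsum n (fun i => F (lift ord0 i) s))).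
  by move=> s; rewrite big_ord_recl.
by apply: continuity_pt_plus => //; apply: IH.
Qed.

Lemma dotD n (a v w : vec n) : dot a (vadd v w) = dot a v + dot a w.
Proof. by rewrite -big_split; apply: eq_bigr => i _ /=; rewrite /vadd; lra. Qed.

Lemma dotZ n t (a v : vec n) : dot a (vscal t v) = t * dot a v.
Proof. by rewrite -Rsum_scal; apply: eq_bigr => i _; rewrite /vscal; lra. Qed.

Lemma dot0 n (a : vec n) : dot a vzero = 0.
Proof. by rewrite /dot big1 // => i _; rewrite /vzero; lra. Qed.

Lemma vnorm_le n (x y : vec n) : (forall i, Rabs (x i) <= Rabs (y i)) -> vnorm x <= vnorm y.
Proof.
by move=> xy; apply: sqrt_le_1_alt; apply: Rsum_le => i; apply: Rsqr_le_abs_1.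
Qed.

Lemma vnorm_le_sum n (x : vec n) : vnorm x <= Rsum n (fun i => Rabs (x i)).
Proof.
have s0 : 0 <= Rsum n (fun i => Rabs (x i)) by apply: Rsum_ge0 => i; exact: Rabs_pos.
rewrite -(sqrt_Rsqr _ s0); apply: sqrt_le_1_alt.
(* Nonnegativity is carried through the induction, since $(a'+b')^2 \ge a'^2+b'^2$ rests on $a'b'
   \ge 0$. *)
suff [] : Rsum n (fun i => x i * x i) <= Rsqr (Rsum n (fun i => Rabs (x i)))
  /\ 0 <= Rsum n (fun i => Rabs (x i)) by [].
elim/big_ind2: _ => [|a b a' b' [H ?] [H' ?]|i _].
- by rewrite /Rsqr; lra.
- by split; rewrite /Rsqr in H H' *; nra.
- by rewrite -Rsqr_abs /Rsqr; split; [lra | exact: Rabs_pos].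
Qed.

(** * Continuity and differentiability in several variables *)

(** The smallest of the [n] radii serves all indices at once, because [A] survives shrinking. *)
Lemma common_delta n (A : 'I_n -> R -> Prop) :
  (forall i d d', A i d -> 0 < d' <= d -> A i d') ->
  (forall i, exists d, 0 < d /\ A i d) ->
  exists d, 0 < d /\ forall i, A i d.
Proof.
elim: n A => [|n IH] A mA hA; first by exists 1; split; [lra|case].
have [d [d0 hd]] := IH (fun i => A (lift ord0 i)) (fun i => mA _) (fun i => hA _).
have [e [e0 he]] := hA ord0.
have m0 : 0 < Rmin d e by apply: Rmin_glb_lt.
exists (Rmin d e); split=> // i.
case: (unliftP ord0 i) => [j|] ->.
  by apply: mA (hd j) _; move: (Rmin_l d e); lra.
by apply: mA he _; move: (Rmin_r d e); lra.
Qed.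

Lemma continuous_curve n (g : R -> vec n) t r :
  (forall i, continuity_pt (fun s => g s i) t) -> 0 < r ->
  locally t (fun s => vdist (g s) (g t) < r).
Proof.
move=> cg r0.
have c : continuity_pt (fun s => Rsum n (fun i => Rabs (g s i - g t i))) t.
  apply: Rsum_continuity => i; apply: (continuity_pt_comp (fun s => g s i - g t i) Rabs).
    by apply: continuity_pt_minus => //; apply: continuity_pt_const.
  exact: Rcontinuity_abs.
have /continuity_pt_locally /(_ (mkposreal _ r0)) := c.
apply: filter_imp => s /=.
rewrite [X in _ - X]big1; last by move=> i _; rewrite Rminus_diag Rabs_R0.
rewrite Rminus_0_r => hs; apply: Rle_lt_trans (vnorm_le_sum _) _.
apply: Rle_lt_trans (Rle_abs _) _; move: hs; congr (_ < _); congr Rabs.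
by apply: eq_bigr => i _; congr Rabs; rewrite /vadd /vscal; lra.
Qed.

Lemma continuity_pt_curve n (U : vec n -> Prop) (f : vec n -> R) (g : R -> vec n) t :
  is_open U -> U (g t) -> continuous_in U f (g t) ->
  (forall i, continuity_pt (fun s => g s i) t) ->
  continuity_pt (fun s => f (g s)) t.
Proof.
move=> oU Ut cf cg; apply/continuity_pt_locally => eps.
have [r [r0 hr]] := oU _ Ut.
have [d [d0 hd]] := cf _ (cond_pos eps).
apply: filter_imp (filter_and _ _ (continuous_curve cg r0) (continuous_curve cg d0)).
by move=> s [/hr Us /(hd _ Us)].
Qed.

(** The class $C^1$ in coordinates, with gradient [df]. Derivatives are taken at parameter 0 only,
    to match [smooth_on]. *)
Definition has_partials {n} (U : vec n -> Prop) (f : vec n -> R) (df : vec n -> vec n) :=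
  (forall i x, U x -> derivable_pt_lim (fun t => f (vadd x (vscal t (vbasis i)))) 0 (df x i))
  /\ (forall i x, U x -> continuous_in U (fun y => df y i) x).

Lemma has_partials_dline n (U : vec n -> Prop) f df (x : vec n) i t :
  has_partials U f df -> U (vadd x (vscal t (vbasis i))) ->
  is_derive (fun s => f (vadd x (vscal s (vbasis i)))) t
    (df (vadd x (vscal t (vbasis i))) i).
Proof.
move=> [hf _] /(hf i) /is_derive_Reals H.
apply: (is_derive_ext (fun s => f (vadd (vadd x (vscal t (vbasis i)))
    (vscal (s - t) (vbasis i))))) => [s|].
  by congr f; apply: functional_extensionality => j; rewrite /vadd /vscal; lra.
have E : t - t = 0 by lra.
pose p := vadd x (vscal t (vbasis i)).
rewrite -[df _ _](Rmult_1_l).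
apply: (is_derive_comp (fun u => f (vadd p (vscal u (vbasis i)))) (fun s => s - t) t).
  by rewrite E.
by auto_derive; lra.
Qed.

(* Corners of the axis-parallel path from [x] to [y]. *)
Definition splice {n} (x y : vec n) (j : nat) : vec n := fun i => if (i < j)%N then y i else x i.

(** Going from [x] to [y] one coordinate at a time, the mean value theorem on each edge gives a
    partial derivative at a nearby point, which differs from the one at [x] by less than [eps]. The
    errors add up edge by edge, hence the $\ell^1$ norm in the bound. *)
Lemma frechet n (U : vec n -> Prop) f df x eps :
  is_open U -> has_partials U f df -> U x -> 0 < eps ->
  exists d, 0 < d /\ forall y, vdist y x < d ->
    Rabs (f y - f x - dot (df x) (vadd y (vscal (-1) x)))
      <= eps * Rsum n (fun i => Rabs (y i - x i)).
Proof.
move=> oU hf Ux e0.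
have [r [r0 hr]] := oU _ Ux.
have [d [d0 hd]] : exists d, 0 < d /\ forall i y, U y -> vdist y x < d ->
    Rabs (df y i - df x i) < eps.
  apply: (@common_delta n (fun i d => forall y, U y -> vdist y x < d ->
     Rabs (df y i - df x i) < eps)).
    by move=> i a b H ? y Uy ?; apply: H => //; lra.
  by move=> i; case: hf => _ hc; have [d [? ?]] := hc i x Ux _ e0; exists d.
exists (Rmin d r); split; first exact: Rmin_glb_lt.
move=> y hy.
(* Corners and edges of the path are, in each coordinate, no farther from [x] than [y] is. *)
have near z : (forall i, Rabs (z i - x i) <= Rabs (y i - x i)) -> U z /\ vdist z x < d.
  move=> hz; have : vdist z x <= vdist y x.
    apply: vnorm_le => i; rewrite /vadd /vscal.
    by move: (hz i); congr (Rabs _ <= Rabs _); lra.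
  by move: (Rmin_l d r) (Rmin_r d r) => *; split; [apply: hr|]; lra.
have step (i : 'I_n) : Rabs (f (splice x y i.+1) - f (splice x y i) - df x i * (y i - x i))
    <= eps * Rabs (y i - x i).
  pose p t := vadd (splice x y i) (vscal t (vbasis i)).
  have p0 : p 0 = splice x y i.
    by apply: functional_extensionality => j; rewrite /p /vadd /vscal; lra.
  have p1 : p (y i - x i) = splice x y i.+1.
    apply: functional_extensionality => j; rewrite /p /vadd /vscal /splice /vbasis ltnS.
    case: (eqVneq j i) => [->|ji]; first by rewrite ltnn leqnn; lra.
    by rewrite [(j <= i)%N]leq_eqVlt -[(_ == _ :> nat)]/(j == i) (negbTE ji) /=; case: ifP; lra.
  (* The increment [y i - x i] may have either sign, hence the interval from [Rmin] to [Rmax]. *)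
  have np t : Rmin 0 (y i - x i) <= t <= Rmax 0 (y i - x i) -> U (p t) /\ vdist (p t) x < d.
    move=> ht; apply: near => j; rewrite /p /vadd /vscal /splice /vbasis.
    case: (eqVneq j i) => [->|ji].
      rewrite ltnn; move: ht; rewrite /Rmin /Rmax /Rabs.
      by repeat case: Rle_dec => ?; repeat case: Rcase_abs => ?; lra.
    case: ifP => _; first by right; congr Rabs; lra.
    by rewrite (_ : _ - _ = 0) ?Rabs_R0; [exact: Rabs_pos|lra].
  have hp t : Rmin 0 (y i - x i) <= t <= Rmax 0 (y i - x i) ->
      is_derive (fun s => f (p s)) t (df (p t) i).
    by move=> /np [Upt _]; apply: has_partials_dline Upt.
  have [xi [hxi]] : exists xi, Rmin 0 (y i - x i) <= xi <= Rmax 0 (y i - x i) /\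
      f (p (y i - x i)) - f (p 0) = df (p xi) i * (y i - x i - 0).
    apply: (MVT_gen (fun s => f (p s)) 0 (y i - x i) (fun t => df (p t) i)).
      by move=> t ht; apply: hp; lra.
    move=> t /hp ht; apply: derivable_continuous_pt; exists (df (p t) i).
    exact/is_derive_Reals.
  rewrite p0 p1 => ->.
  have [Uxi dxi] := np _ hxi.
  rewrite (_ : _ - _ = (df (p xi) i - df x i) * (y i - x i)); last by lra.
  rewrite Rabs_mult; apply: Rmult_le_compat_r; first exact: Rabs_pos.
  by apply: Rlt_le; apply: hd.
rewrite -Rsum_scal.
have -> : f y - f x - dot (df x) (vadd y (vscal (-1) x)) =
    Rsum n (fun i : 'I_n => f (splice x y i.+1) - f (splice x y i) - df x i * (y i - x i)).
  have -> : f y - f x = Rsum n (fun i : 'I_n => f (splice x y i.+1) - f (splice x y i)).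
    rewrite (Rsum_telescope n (fun j => f (splice x y j))); congr (f _ - f _);
      by apply: functional_extensionality => i; rewrite /splice ?ltn_ord.
  rewrite (_ : dot _ _ = - Rsum n (fun i => - 1 * (df x i * (y i - x i)))).
    rewrite /Rminus Ropp_involutive -big_split /=.
    by apply: eq_bigr => i _; lra.
  rewrite Rsum_scal (_ : dot _ _ = Rsum n (fun i => df x i * (y i - x i))); first by lra.
  by apply: eq_bigr => i _; rewrite /vadd /vscal; congr (_ * _); lra.
by apply: Rle_trans (Rsum_abs _) _; apply: Rsum_le.
Qed.

(** The linear part of [f] along [g] is differentiated termwise; the remainder has derivative 0,
    being small against the $\ell^1$ displacement of [g] by [frechet], which is itself at most
    linear in time. *)
Lemma chain_rule n (U : vec n -> Prop) f df (g : R -> vec n) (dg : vec n) t :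
  is_open U -> has_partials U f df -> U (g t) ->
  (forall i, derivable_pt_lim (fun s => g s i) t (dg i)) ->
  derivable_pt_lim (fun s => f (g s)) t (dot (df (g t)) dg).
Proof.
move=> oU hf Ut hg.
have cg i : continuity_pt (fun s => g s i) t.
  by apply: derivable_continuous_pt; exists (dg i); exact: hg.
pose lin s := dot (df (g t)) (vadd (g s) (vscal (-1) (g t))).
have hlin : is_derive lin t (dot (df (g t)) dg).
  rewrite /lin /dot; apply: (@Rsum_is_derive n
    (fun i s => df (g t) i * vadd (g s) (vscal (-1) (g t)) i)) => i.
  apply: is_derive_scal; rewrite -[dg i]Rplus_0_r; apply: is_derive_plus.
    exact/is_derive_Reals.
  exact: is_derive_const.
suff hrem : is_derive (fun s => f (g s) - f (g t) - lin s) t 0.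
  apply/is_derive_Reals.
  apply: (is_derive_ext (fun s => (f (g s) - f (g t) - lin s) + lin s + f (g t))) => [s|].
    by lra.
  rewrite (_ : dot _ _ = 0 + dot (df (g t)) dg + 0); last by lra.
  apply: is_derive_plus (is_derive_const _ _).
  exact: (@is_derive_plus _ _ (fun s => f (g s) - f (g t) - lin s) lin).
have l0 : lin t = 0.
  by rewrite /lin /dot big1 // => i _; rewrite /vadd /vscal; lra.
(* Tolerance 1 in the definition of the derivative bounds each difference quotient near [t] by
   $|dg_i|+1$. *)
have [d [d0 hd]] : exists d, 0 < d /\ forall i s, Rabs (s - t) < d ->
    Rabs (g s i - g t i) <= (Rabs (dg i) + 1) * Rabs (s - t).
  apply: (@common_delta n (fun i d => forall s, Rabs (s - t) < d ->
    Rabs (g s i - g t i) <= (Rabs (dg i) + 1) * Rabs (s - t))).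
    by move=> i a b H ? s ?; apply: H; lra.
  move=> i; have [[d d0] hd] := hg i 1 Rlt_0_1; exists d; split=> // s hs.
  case: (Req_dec s t) => [->|st]; first by rewrite !Rminus_diag Rabs_R0; lra.
  have st0 : s - t <> 0 by lra.
  have := hd _ st0 hs; rewrite (_ : t + (s - t) = s); last by lra.
  move=> h1; have : Rabs ((g s i - g t i) / (s - t)) <= Rabs (dg i) + 1.
    have := Rabs_triang ((g s i - g t i) / (s - t) - dg i) (dg i).
    by rewrite (_ : _ - _ + _ = (g s i - g t i) / (s - t)); lra.
  move=> h2; rewrite {1}(_ : g s i - g t i = (g s i - g t i) / (s - t) * (s - t)); last by field.
  by rewrite Rabs_mult; apply: Rmult_le_compat_r => //; exact: Rabs_pos.
pose M := Rsum n (fun i => Rabs (dg i) + 1).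
have M0 : 0 <= M by apply: Rsum_ge0 => i; move: (Rabs_pos (dg i)); lra.
apply/is_derive_Reals => eps e0.
(* The [+ 1] keeps the denominator positive even when [n = 0], and the factor 1/2 turns $M/(M+1) \le
   1$ into a strict estimate. *)
have e1 : 0 < eps / (M + 1) / 2 by do 2 (apply: Rdiv_lt_0_compat; try lra).
have [e [e20 he]] := frechet oU hf Ut e1.
have [[e' e'0] he'] := continuous_curve cg e20.
have m0 : 0 < Rmin d e' by apply: Rmin_glb_lt.
exists (mkposreal _ m0) => u u0 /= hu.
have hud : Rabs (t + u - t) < d by move: (Rmin_l d e'); rewrite (_ : t + u - t = u); lra.
have hue : vdist (g (t + u)) (g t) < e.
  apply: he'; rewrite /ball /= /AbsRing_ball /= /abs /minus /plus /opp /=.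
  by move: (Rmin_r d e'); rewrite (_ : t + u + - t = u); lra.
rewrite l0 (_ : f (g t) - f (g t) - 0 = 0); last by lra.
rewrite !Rminus_0_r /Rdiv Rabs_mult Rabs_inv.
have u1 : 0 < Rabs u by exact: Rabs_pos_lt.
apply: (Rmult_lt_reg_r (Rabs u)) => //.
rewrite Rmult_assoc Rinv_l ?Rmult_1_r; last by lra.
apply: Rle_lt_trans (he _ hue) _.
have : Rsum n (fun i => Rabs (g (t + u) i - g t i)) <= Rabs u * M.
  rewrite /M -Rsum_scal; apply: Rsum_le => i.
  have := hd i _ hud; rewrite (_ : t + u - t = u); lra.
move=> hs; apply: Rle_lt_trans (Rmult_le_compat_l _ _ _ (Rlt_le _ _ e1) hs) _.
have -> : eps / (M + 1) / 2 * (Rabs u * M) = (eps * Rabs u) * (M / (M + 1) / 2) by field; lra.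
rewrite -[X in _ < X]Rmult_1_r; apply: Rmult_lt_compat_l; first exact: Rmult_lt_0_compat.
suff : M / (M + 1) <= 1 by lra.
by apply/Rcomplements.Rle_div_l; lra.
Qed.

Lemma open_curve n (U : vec n -> Prop) (g : R -> vec n) t :
  is_open U -> U (g t) -> (forall i, continuity_pt (fun s => g s i) t) ->
  locally t (fun s => U (g s)).
Proof.
move=> oU /oU [r [r0 hr]] cg.
by apply: filter_imp (continuous_curve cg r0) => s /hr.
Qed.

Lemma derivable_line n (x v : vec n) t i :
  derivable_pt_lim (fun s => vadd x (vscal s v) i) t (v i).
Proof. by apply/is_derive_Reals; rewrite /vadd /vscal; auto_derive; lra. Qed.

Lemma continuity_line n (x v : vec n) t i : continuity_pt (fun s => vadd x (vscal s v) i) t.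
Proof.
by apply: derivable_continuous_pt; exists (v i); exact: derivable_line.
Qed.

Lemma line0 n (x v : vec n) : vadd x (vscal 0 v) = x.
Proof. by apply: functional_extensionality => i; rewrite /vadd /vscal; lra. Qed.

Lemma has_partials_ext n (U : vec n -> Prop) f g df :
  is_open U -> (forall x, U x -> f x = g x) -> has_partials U f df -> has_partials U g df.
Proof.
move=> oU fg [hf cf]; split=> // i x Ux; apply/is_derive_Reals.
have /is_derive_Reals := hf i x Ux; apply: is_derive_ext_loc.
apply: filter_imp (@open_curve _ U (fun s => vadd x (vscal s (vbasis i))) 0 oU _ _).
- by move=> s /fg.
- by rewrite line0.
- by move=> j; exact: continuity_line.
Qed.

(** Two choices of the first derivative agree on the smaller of the two intervals. This pins down
    the function [q] in [short_path]. *)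
Lemma dderiv2_unique n (f : vec n -> R) x v l l' :
  dderiv2 f x v l -> dderiv2 f x v l' -> l = l'.
Proof.
move=> [d [e [e0 [hd hl]]]] [d' [e' [e'0 [hd' hl']]]].
apply: (uniqueness_limite d' 0) => //; apply/is_derive_Reals.
move/is_derive_Reals: hl; apply: is_derive_ext_loc.
have m0 : 0 < Rmin e e' by apply: Rmin_glb_lt.
exists (mkposreal _ m0) => t; rewrite /ball /= /AbsRing_ball /abs /minus /plus /opp /=.
rewrite Ropp_0 Rplus_0_r => ht; move: (Rmin_l e e') (Rmin_r e e') => ? ?.
by apply: (uniqueness_limite _ _ _ _ (hd t _) (hd' t _)); lra.
Qed.

(** * Pointwise inequalities between the Hessians of $-\log H$ and $-\log(H+c)$ *)

(** Here [p] and [q] stand for the first and second derivatives of [H] along a vector. With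
    $X=1/(H+c)$ and $Y=1/H$, the right side minus the left is $(X-Y)(p^2(X+Y)-q)$, and both factors
    are nonnegative. *)
Lemma log_hessian_mono k c H p q : 1 < k -> c <= 0 -> 0 < H + c ->
  q <= (k - 1) / k * (p ^ 2 / H) ->
  (p / H) ^ 2 - q / H <= (p / (H + c)) ^ 2 - q / (H + c).
Proof.
move=> k1 c0 Hc; have H0 : 0 < H by lra.
have YX : / H <= / (H + c) by apply: Rinv_le_contravar; lra.
have Y0 : 0 < / H by exact: Rinv_0_lt_compat.
have a1 : (k - 1) / k <= 1 by apply/Rcomplements.Rle_div_l; lra.
rewrite /Rdiv in a1 *; set X := / (H + c) in YX *; set Y := / H in YX Y0 *.
set a := _ * / k in a1 * => hq.
have : 0 <= (a * (p ^ 2 * Y) - q) * (X - Y) by apply: Rmult_le_pos; lra.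
have : 0 <= p ^ 2 * ((X - Y) * (X + Y - a * Y)).
  by do 2 (apply: Rmult_le_pos; try nra).
by nra.
Qed.

(** Source of the Lipschitz constant $\sqrt k$. With [X] and [Y] as inverses of [H + c] and [H],
    inserting the bound on [q] leaves $(k-1)p^2X(X-Y) \ge 0$. *)
Lemma log_deriv_le k c H p q : 1 < k -> c <= 0 -> 0 < H + c ->
  q <= (k - 1) / k * (p ^ 2 / H) ->
  (p / (H + c)) ^ 2 <= k * ((p / (H + c)) ^ 2 - q / (H + c)).
Proof.
move=> k1 c0 Hc; have H0 : 0 < H by lra.
have YX : / H <= / (H + c) by apply: Rinv_le_contravar; lra.
have Y0 : 0 < / H by exact: Rinv_0_lt_compat.
have ka : k * ((k - 1) / k) = k - 1 by field; lra.
rewrite /Rdiv in ka *; set X := / (H + c) in YX *; set Y := / H in YX Y0 *.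
set a := _ * / k in ka * => hq.
have : 0 <= k * ((a * (p ^ 2 * Y) - q) * X) by do 2 (apply: Rmult_le_pos; try lra).
have : 0 <= (k - 1) * (p ^ 2 * (X * (X - Y))) by do 3 (apply: Rmult_le_pos; try nra).
have -> : k * ((a * (p ^ 2 * Y) - q) * X) = (k * a) * p ^ 2 * Y * X - k * q * X by lra.
by rewrite ka; nra.
Qed.

(** Write $q = ap^2Y - B$ with $a=(k-1)/k$ and slack $B \ge 0$. Since $k(1-a)=1$, the factor [k]
    gives the right side a full $p^2(rY)^2$, where $r=m/(m+c)$; then $X \le rY$ is enough for the
    terms in $p^2$ and in [B] separately. *)
Lemma log_hessian_le k c m H p q : 1 < k -> c <= 0 -> 0 < m + c -> m <= H ->
  q <= (k - 1) / k * (p ^ 2 / H) ->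
  (p / (H + c)) ^ 2 - q / (H + c) <= k * (m / (m + c)) ^ 2 * ((p / H) ^ 2 - q / H).
Proof.
move=> k1 c0 mc mH; have H0 : 0 < H by lra.
have Y0 : 0 < / H by exact: Rinv_0_lt_compat.
have X0 : 0 < / (H + c) by apply: Rinv_0_lt_compat; lra.
have ka : k * ((k - 1) / k) = k - 1 by field; lra.
have a0 : 0 < (k - 1) / k by apply: Rdiv_lt_0_compat; lra.
(* For [c <= 0] the quotient $H/(H+c)$ does not increase with [H], so it is largest at [m]. *)
have XRY : / (H + c) <= m / (m + c) * / H.
  apply: (Rmult_le_reg_r ((H + c) * ((m + c) * H))); first by repeat apply: Rmult_lt_0_compat; lra.
  have -> : / (H + c) * ((H + c) * ((m + c) * H)) = (m + c) * H by field; lra.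
  have -> : m / (m + c) * / H * ((H + c) * ((m + c) * H)) = m * (H + c) by field; lra.
  by nra.
have R1 : 1 <= m / (m + c) by apply/Rcomplements.Rle_div_r; lra.
move: R1 XRY; set r := m / (m + c) => R1 XRY.
rewrite /Rdiv in ka a0 *; set X := / (H + c) in XRY X0 *; set Y := / H in XRY Y0 *.
set a := _ * / k in ka a0 * => hq.
set B := a * (p ^ 2 * Y) - q; have B0 : 0 <= B by rewrite /B; lra.
have -> : q = a * (p ^ 2 * Y) - B by rewrite /B; lra.
have BX : B * X <= k * r ^ 2 * (B * Y).
  have : B * X <= B * (r * Y) by exact: Rmult_le_compat_l.
  have : r * (B * Y) <= k * r ^ 2 * (B * Y).
    apply: Rmult_le_compat_r; first by apply: Rmult_le_pos; lra.
    by nra.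
  by lra.
have XX : p ^ 2 * X ^ 2 <= p ^ 2 * (r * Y) ^ 2.
  apply: Rmult_le_compat_l; first exact: pow2_ge_0.
  by apply: pow_incr; lra.
have : 0 <= a * (p ^ 2 * (Y * X)).
  apply: Rmult_le_pos; first by lra.
  by apply: Rmult_le_pos; [exact: pow2_ge_0 | apply: Rmult_le_pos; lra].
have -> : k * r ^ 2 * ((p * Y) ^ 2 - (a * (p ^ 2 * Y) - B) * Y) =
  k * r ^ 2 * (B * Y) + (k - k * a) * (p ^ 2 * (r * Y) ^ 2) by ring.
by rewrite ka; nra.
Qed.

(** * One-variable derivatives and lines through a scaled point *)

Lemma is_derive_uniq (f : R -> R) x l l' : is_derive f x l -> is_derive f x l' -> l = l'.
Proof. by move=> /is_derive_unique <- /is_derive_unique. Qed.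

Lemma dderiv2P n f x v (d : R -> R) l :
  locally 0 (fun t => is_derive (fun s => f (vadd x (vscal s v))) t (d t)) ->
  is_derive d 0 l -> @dderiv2 n f x v l.
Proof.
move=> [[e e0] he] hd; exists d, e; split=> //; split; last exact/is_derive_Reals.
move=> t ht; apply/is_derive_Reals; apply: he.
by rewrite /ball /= /AbsRing_ball /abs /minus /plus /opp /= Ropp_0 Rplus_0_r.
Qed.

Lemma Rpower_pred t a : 0 < t -> Rpower t a * / t = Rpower t (a - 1).
Proof. by move=> t0; rewrite /Rminus Rpower_plus Rpower_Ropp Rpower_1. Qed.

Lemma scal_line n t (x v : vec n) s : 0 < t ->
  vadd (vscal t x) (vscal s v) = vscal t (vadd x (vscal (s / t) v)).
Proof.
by move=> t0; apply: functional_extensionality => i; rewrite /vadd /vscal; field; lra.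
Qed.

Lemma is_derive_div (f : R -> R) t l : is_derive f 0 l -> is_derive (fun s => f (s / t)) 0 (/ t * l).
Proof.
move=> hf; apply: (is_derive_comp f (fun s => s / t)).
  by rewrite /Rdiv Rmult_0_l.
by rewrite /Rdiv; auto_derive; lra.
Qed.

Lemma locally_comp (f : R -> R) (A : R -> Prop) x :
  continuous f x -> locally (f x) A -> locally x (fun t => A (f t)).
Proof. by move=> c; exact: (c A). Qed.

Lemma locally_div (A : R -> Prop) t : t <> 0 -> locally 0 A -> locally 0 (fun s => A (s / t)).
Proof.
move=> t0 hA; have c : continuous (fun s => s / t) 0.
  by apply: ex_derive_continuous; auto_derive.
by apply: c; rewrite /Rdiv Rmult_0_l.
Qed.

Definition C1_curve {n} (W : vec n -> Prop) (gam dgam : R -> vec n) : Prop :=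
  forall t, 0 <= t <= 1 -> W (gam t) /\ forall i,
    derivable_pt_lim (fun s => gam s i) t (dgam t i) /\ continuity_pt (fun s => dgam s i) t.

(** * First and second derivatives of the homogeneous function [h] *)

Section LogHessian.
Context (n : nat) (U : vec n -> Prop) (h : vec n -> R) (k : R) (D : seq 'I_n -> vec n -> R).
Hypothesis oU : is_open U.
Hypothesis cone : forall t x, 0 < t -> U x -> U (vscal t x).
Hypothesis D0 : forall x, U x -> D [::] x = h x.
Hypothesis D1 : forall s i x, U x ->
  derivable_pt_lim (fun t => D s (vadd x (vscal t (vbasis i)))) 0 (D (i :: s) x).
Hypothesis Dc : forall s x, U x -> continuous_in U (D s) x.
Hypothesis hpos : forall x, U x -> 0 < h x.
Hypothesis k1 : 1 < k.
Hypothesis hom : forall t x, 0 < t -> U x -> h (vscal t x) = Rpower t k * h x.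
Hypothesis neg : forall x v l, U x -> h x = 1 -> dderiv h x v 0 -> v <> vzero ->
  dderiv2 h x v l -> 0 < - l.

Definition grad x v : R := dot (fun i => D [:: i] x) v.
(** The head of an index list is the derivative taken last, so this is what differentiating [grad]
    along [v] produces. *)
Definition hess x v : R := dot (fun i => dot (fun j => D [:: j; i] x) v) v.

Lemma partialsD s : has_partials U (D s) (fun x i => D (i :: s) x).
Proof. by split=> i x Ux; [exact: D1 | exact: Dc]. Qed.

Lemma partials_h : has_partials U h (fun x i => D [:: i] x).
Proof. exact: has_partials_ext oU D0 (partialsD [::]). Qed.

Lemma h_line x v t : U (vadd x (vscal t v)) ->
  is_derive (fun s => h (vadd x (vscal s v))) t (grad (vadd x (vscal t v)) v).
Proof.
move=> Ut; apply/is_derive_Reals.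
apply: (chain_rule (g := fun s => vadd x (vscal s v)) oU partials_h Ut) => i.
exact: derivable_line.
Qed.

Lemma grad_line x v : U x ->
  is_derive (fun s => grad (vadd x (vscal s v)) v) 0 (hess x v).
Proof.
move=> Ux; rewrite -{2}(line0 x v).
apply: (@Rsum_is_derive n (fun i s => D [:: i] (vadd x (vscal s v)) * v i)) => i.
have Ux' : U (vadd x (vscal 0 v)) by rewrite line0.
have := chain_rule (g := fun s => vadd x (vscal s v)) oU (partialsD [:: i]) Ux'
  (fun j => derivable_line x v 0 j) => /is_derive_Reals H.
set l := dot _ _ in H *.
apply: (is_derive_ext (fun s => v i * D [:: i] (vadd x (vscal s v)))) => [s|]; first by lra.
by rewrite Rmult_comm; apply: is_derive_scal.
Qed.

Lemma U_line x v t : U (vadd x (vscal t v)) -> locally t (fun s => U (vadd x (vscal s v))).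
Proof.
move=> Ut; apply: (@open_curve _ U (fun s => vadd x (vscal s v)) t oU Ut) => i.
exact: continuity_line.
Qed.

Lemma U_line0 x v : U x -> locally 0 (fun s => U (vadd x (vscal s v))).
Proof. by move=> Ux; apply: U_line; rewrite line0. Qed.

Lemma h_line0 x v : U x -> is_derive (fun s => h (vadd x (vscal s v))) 0 (grad x v).
Proof. by move=> Ux; rewrite -{2}(line0 x v); apply: h_line; rewrite line0. Qed.

Lemma dderiv2_h x v : U x -> dderiv2 h x v (hess x v).
Proof.
move=> Ux; apply: dderiv2P (grad_line v Ux).
by apply: filter_imp (U_line0 v Ux) => s; exact: h_line.
Qed.

(** Differentiate $h(tx+sv) = t^k h(x+(s/t)v)$ in [s] at 0; the inner factor $1/t$ lowers the
    exponent by one. *)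
Lemma grad_hom t x v : 0 < t -> U x -> grad (vscal t x) v = Rpower t (k - 1) * grad x v.
Proof.
move=> t0 Ux; apply: (is_derive_uniq (h_line0 v (cone t0 Ux))).
rewrite -Rpower_pred // Rmult_assoc.
apply: (is_derive_ext_loc (fun s => Rpower t k * h (vadd x (vscal (s / t) v)))).
  have tn0 : t <> 0 by lra.
  by apply: filter_imp (locally_div tn0 (U_line0 v Ux)) => s Us; rewrite scal_line // hom.
apply: is_derive_scal.
exact: (is_derive_div (f := fun s => h (vadd x (vscal s v)))) (h_line0 v Ux).
Qed.

Lemma hess_hom t x v : 0 < t -> U x ->
  hess (vscal t x) v = Rpower t (k - 1 - 1) * hess x v.
Proof.
move=> t0 Ux; apply: (is_derive_uniq (grad_line v (cone t0 Ux))).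
rewrite -Rpower_pred // Rmult_assoc.
apply: (is_derive_ext_loc (fun s => Rpower t (k - 1) * grad (vadd x (vscal (s / t) v)) v)).
  have tn0 : t <> 0 by lra.
  by apply: filter_imp (locally_div tn0 (U_line0 v Ux)) => s Us; rewrite scal_line // grad_hom.
apply: is_derive_scal.
exact: (is_derive_div (f := fun s => grad (vadd x (vscal s v)) v)) (grad_line v Ux).
Qed.

(** Euler's identity, from differentiating $h((1+s)x) = (1+s)^k h(x)$ at $s=0$. *)
Lemma grad_euler x : U x -> grad x x = k * h x.
Proof.
move=> Ux; apply: (is_derive_uniq (h_line0 x Ux)).
apply: (is_derive_ext_loc (fun s => Rpower (1 + s) k * h x)).
  have l1 : locally 0 (fun s => -1 < s) by apply: open_gt; lra.
  apply: filter_imp l1 => s s1; rewrite -hom //; last by lra.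
  by congr h; apply: functional_extensionality => i; rewrite /vadd /vscal; lra.
rewrite /Rpower; auto_derive; first by lra.
by rewrite Rplus_0_r ln_1 Rmult_0_r exp_0; field.
Qed.

(** Definiteness is assumed on the level $h=1$ only; scaling [x] onto that level multiplies [grad]
    and [hess] by positive factors, so tangency and sign carry over. *)
Lemma hess_tangent_le0 x w : U x -> grad x w = 0 -> hess x w <= 0.
Proof.
move=> Ux gw; have hx := hpos Ux.
case: (classic (w = vzero)) => [->|w0]; first by rewrite /hess dot0; lra.
(* The factor for which $h(mx) = m^k h(x) = 1$. *)
pose m := Rpower (h x) (- / k).
have m0 : 0 < m by exact: exp_pos.
have Umx := cone m0 Ux.
suff : 0 < - hess (vscal m x) w.
  rewrite hess_hom // => H; have := exp_pos ((k - 1 - 1) * ln m); rewrite -/(Rpower _ _); nra.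
apply: (neg Umx _ _ w0 (dderiv2_h w Umx)).
  rewrite hom // /m Rpower_mult (_ : - / k * k = -1); last by field; lra.
  by rewrite Rpower_Ropp Rpower_1 //; field; lra.
by apply/is_derive_Reals; have := h_line0 w Umx; rewrite grad_hom // gw Rmult_0_r.
Qed.

(* Write [v = a x + w] with [w] tangent to the level set of [h]; by homogeneity
   [x + t v = (1 + t a) (x + s w)] with [s = t / (1 + t a)], which reduces the
   Hessian at [v] to those at [x] and at [w]. *)
Lemma hess_bound x v : U x -> hess x v <= (k - 1) / k * ((grad x v) ^ 2 / h x).
Proof.
move=> Ux; have hx := hpos Ux.
(* By Euler's identity this is the radial coefficient that makes $v-ax$ tangent. *)
pose a := grad x v / (k * h x).
pose w := vadd v (vscal (- a) x).
have gw : grad x w = 0.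
  by rewrite /grad /w dotD dotZ -!/(grad _ _) grad_euler // /a; field; lra.
suff -> : hess x v = k * (k - 1) * a ^ 2 * h x + hess x w.
  have := hess_tangent_le0 Ux gw.
  suff -> : (k - 1) / k * ((grad x v) ^ 2 / h x) = k * (k - 1) * a ^ 2 * h x by lra.
  by rewrite /a; field; lra.
apply: (is_derive_uniq (grad_line v Ux)).
pose F1 s := h (vadd x (vscal s w)).
pose F2 s := grad (vadd x (vscal s w)) w.
have dF1 : is_derive F1 0 0 by have := h_line0 w Ux; rewrite gw.
have dF2 : is_derive F2 0 (hess x w) by exact: grad_line.
have F10 : F1 0 = h x by rewrite /F1 line0.
have F20 : F2 0 = 0 by rewrite /F2 line0.
pose sg t := t / (1 + t * a).
have sg0 : sg 0 = 0 by rewrite /sg; lra.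
have dsg : is_derive sg 0 1 by rewrite /sg; auto_derive; [lra | field].
(* Besides the rescaling, $v = a(x+sw)+(1-as)w$, and Euler's identity evaluates [grad] on the first
   summand. At 0 both [F2] and the derivative of [F1] vanish, so no cross term survives. *)
apply: (is_derive_ext_loc (fun t => Rpower (1 + t * a) (k - 1) *
   (a * k * F1 (sg t) + (1 - a * sg t) * F2 (sg t)))).
  have l1 : locally 0 (fun t => 0 < 1 + t * a).
    apply: (locally_comp (f := fun t => 1 + t * a) (A := fun u => 0 < u)); last by apply: open_gt; lra.
    by apply: ex_derive_continuous; auto_derive.
  have l2 : locally 0 (fun t => U (vadd x (vscal (sg t) w))).
    apply: (locally_comp (A := fun u => U (vadd x (vscal u w)))); last by rewrite sg0; exact: U_line0.
    by apply: ex_derive_continuous; exists 1.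
  apply: filter_imp (filter_and _ _ l1 l2) => t [t1 Us].
  have -> : vadd x (vscal t v) = vscal (1 + t * a) (vadd x (vscal (sg t) w)).
    by apply: functional_extensionality => i; rewrite /sg /w /vadd /vscal; field; lra.
  rewrite grad_hom //; congr (_ * _).
  have -> : v = vadd (vscal a (vadd x (vscal (sg t) w))) (vscal (1 - a * sg t) w).
    by apply: functional_extensionality => i; rewrite /w /vadd /vscal; lra.
  by rewrite /grad dotD !dotZ -!/(grad _ _) grad_euler // /F1 /F2; ring.
rewrite /Rpower; auto_derive.
  rewrite sg0; repeat split; try lra; try by eexists; eassumption.
rewrite sg0 (is_derive_unique _ _ _ dF1) (is_derive_unique _ _ _ dF2)
  (is_derive_unique _ _ _ dsg) F10 F20.
rewrite Rmult_0_l Rplus_0_r ln_1 Rmult_0_r exp_0; field.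
Qed.

(** * The metrics $g'_c$ and their continuity along $C^1$ curves *)

(** The quadratic form of $g'_c$ at [x]; the value [c = 0] gives $g'$. *)
Definition log_metric c x v : R := (grad x v / (h x + c)) ^ 2 - hess x v / (h x + c).

Lemma dderiv2_log c x v : U x -> 0 < h x + c ->
  dderiv2 (fun y => ln (h y + c)) x v (- log_metric c x v).
Proof.
move=> Ux hc.
pose F t := h (vadd x (vscal t v)).
pose G t := grad (vadd x (vscal t v)) v.
have dF : is_derive F 0 (grad x v) by exact: h_line0.
have dG : is_derive G 0 (hess x v) by exact: grad_line.
have F0 : F 0 = h x by rewrite /F line0.
have G0 : G 0 = grad x v by rewrite /G line0.
apply: (@dderiv2P _ _ _ _ (fun t => G t / (F t + c))).
  have l1 : locally 0 (fun t => - c < F t).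
    apply: (locally_comp (A := fun u => - c < u)); last by rewrite F0; apply: open_gt; lra.
    by apply: ex_derive_continuous; eexists; exact: dF.
  apply: filter_imp (filter_and _ _ l1 (U_line0 v Ux)) => t [t1 Ut].
  have dFt : is_derive F t (G t) by exact: h_line.
  change (is_derive (fun s => ln (F s + c)) t (G t / (F t + c))); auto_derive.
    by split; [eexists; exact: dFt | split=> //; lra].
  rewrite (is_derive_unique _ _ _ dFt); field; lra.
auto_derive.
  by split; [eexists; exact: dG | split; [eexists; exact: dF | rewrite F0; split=> //; lra]].
rewrite (is_derive_unique _ _ _ dF) (is_derive_unique _ _ _ dG) F0 G0 /log_metric; field; lra.
Qed.

Lemma C1_curve_deriv_h gam dgam t : C1_curve U gam dgam -> 0 <= t <= 1 ->
  is_derive (fun s => h (gam s)) t (grad (gam t) (dgam t)).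
Proof.
move=> hg /hg [Ut H]; apply/is_derive_Reals; apply: (chain_rule oU partials_h Ut) => i.
by case: (H i).
Qed.

Lemma C1_curve_continuity_D s gam dgam t : C1_curve U gam dgam -> 0 <= t <= 1 ->
  continuity_pt (fun u => D s (gam u)) t.
Proof.
move=> hg /hg [Ut H]; apply: (continuity_pt_curve oU Ut (Dc _ Ut)) => i.
by apply: derivable_continuous_pt; exists (dgam t i); case: (H i).
Qed.

Lemma continuity_dot (a v : R -> vec n) t :
  (forall i, continuity_pt (fun s => a s i) t) ->
  (forall i, continuity_pt (fun s => v s i) t) ->
  continuity_pt (fun s => dot (a s) (v s)) t.
Proof.
move=> ca cv; apply: (@Rsum_continuity n (fun i s => a s i * v s i)) => i.
exact: continuity_pt_mult.
Qed.

Lemma C1_curve_continuity_grad gam dgam t : C1_curve U gam dgam -> 0 <= t <= 1 ->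
  continuity_pt (fun s => grad (gam s) (dgam s)) t.
Proof.
move=> hg t01; have [_ H] := hg t t01.
apply: (@continuity_dot (fun s i => D [:: i] (gam s)) dgam) => i; last by case: (H i).
exact: C1_curve_continuity_D hg t01.
Qed.

Lemma C1_curve_continuity_hess gam dgam t : C1_curve U gam dgam -> 0 <= t <= 1 ->
  continuity_pt (fun s => hess (gam s) (dgam s)) t.
Proof.
move=> hg t01; have [_ H] := hg t t01.
have H2 i : continuity_pt (fun s => dgam s i) t by case: (H i).
apply: (@continuity_dot (fun s i => dot (fun j => D [:: j; i] (gam s)) (dgam s)) dgam) => // i.
apply: (@continuity_dot (fun s j => D [:: j; i] (gam s)) dgam) => // j.
exact: C1_curve_continuity_D hg t01.
Qed.

(** * Lengths for $g'_c$, with [W] to be taken as [U] when [c = 0] and as $U_c$ when [c < 0] *)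

Section Shifted.
Context (c : R) (W : vec n -> Prop).
Hypothesis c0 : c <= 0.
Hypothesis WU : forall x, W x -> U x /\ 0 < h x + c.

Lemma C1_curve_U gam dgam : C1_curve W gam dgam -> C1_curve U gam dgam.
Proof. by move=> hg t /hg [/WU []]. Qed.

Lemma C1_curve_continuity_hc gam dgam t : C1_curve W gam dgam -> 0 <= t <= 1 ->
  continuity_pt (fun s => h (gam s) + c) t.
Proof.
move=> hg t01; apply: continuity_pt_plus; last exact: continuity_pt_const.
apply: derivable_continuous_pt; exists (grad (gam t) (dgam t)).
by apply/is_derive_Reals; apply: C1_curve_deriv_h t01; exact: C1_curve_U.
Qed.

Lemma C1_curve_continuity_dlog gam dgam t : C1_curve W gam dgam -> 0 <= t <= 1 ->
  continuity_pt (fun s => grad (gam s) (dgam s) / (h (gam s) + c)) t.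
Proof.
move=> hg t01; apply: continuity_pt_div.
- exact: C1_curve_continuity_grad (C1_curve_U hg) t01.
- exact: C1_curve_continuity_hc hg t01.
- by have [/WU [_ ?] _] := hg t t01; lra.
Qed.

Definition speed (gam dgam : R -> vec n) t : R := sqrt (log_metric c (gam t) (dgam t)).

Lemma continuous_speed gam dgam t : C1_curve W gam dgam -> 0 <= t <= 1 ->
  continuous (speed gam dgam) t.
Proof.
move=> hg t01; apply: (continuous_comp (fun s => log_metric c (gam s) (dgam s)) sqrt);
  last exact: continuous_sqrt.
apply/continuity_pt_filterlim; apply: continuity_pt_minus.
  apply: (continuity_pt_comp (fun s => grad (gam s) (dgam s) / (h (gam s) + c)) (fun u => u ^ 2)).
    exact: C1_curve_continuity_dlog.
  by apply: derivable_continuous_pt; apply: derivable_pt_pow.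
apply: continuity_pt_div.
- exact: C1_curve_continuity_hess (C1_curve_U hg) t01.
- exact: C1_curve_continuity_hc hg t01.
- by have [/WU [_ ?] _] := hg t t01; lra.
Qed.

Lemma ex_RInt_speed gam dgam a b : C1_curve W gam dgam -> 0 <= a <= b -> b <= 1 ->
  ex_RInt (speed gam dgam) a b.
Proof.
move=> hg ab b1; apply: ex_RInt_continuous => t.
by rewrite Rmin_left ?Rmax_right; try lra; move=> ?; apply: continuous_speed => //; lra.
Qed.

(** Replaces [q] by the explicit Hessian, which uniqueness of second derivatives forces; conversely,
    continuity of the speed supplies the integrability witness. *)
Lemma short_pathP x y eps :
  short_path W (fun z => ln (h z + c)) x y eps <->
  exists gam dgam, [/\ gam 0 = x, gam 1 = y, C1_curve W gam dgam &
    RInt (speed gam dgam) 0 1 < eps].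
Proof.
split=> [[gam [dgam [q [g0 [g1 [gW [dg [cg [hq [pr len]]]]]]]]]]|[gam [dgam [g0 g1 hg len]]]].
  have hg : C1_curve W gam dgam.
    by move=> t t01; split=> [|i]; [exact: gW|split; [exact: dg|exact: cg]].
  exists gam, dgam; split=> //.
  move: len; rewrite -RInt_Reals; congr (_ < _); apply: RInt_ext => t.
  rewrite Rmin_left ?Rmax_right; try lra; move=> t01.
  have t01' : 0 <= t <= 1 by lra.
  have [Ut hc] := WU (gW t t01').
  by rewrite (dderiv2_unique (hq t t01') (dderiv2_log _ Ut hc)) Ropp_involutive.
have E : forall t, speed gam dgam t = sqrt (- - log_metric c (gam t) (dgam t)).
  by move=> t; rewrite Ropp_involutive.
exists gam, dgam, (fun t => - log_metric c (gam t) (dgam t)).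
split=> //; split=> //.
split; first by move=> t /hg [].
split; first by move=> t i /hg [_ /(_ i) []].
split; first by move=> t i /hg [_ /(_ i) []].
split; first by move=> t /hg [/WU [Ut hc] _]; exact: dderiv2_log.
have pr : Riemann_integrable (fun t => sqrt (- - log_metric c (gam t) (dgam t))) 0 1.
  apply: ex_RInt_Reals_0; apply: (ex_RInt_ext (speed gam dgam)) => [t _|]; first exact: E.
  by apply: ex_RInt_speed => //; lra.
by exists pr; rewrite -RInt_Reals; rewrite -(RInt_ext (speed gam dgam)).
Qed.

Lemma dlog_le_speed gam dgam t : W (gam t) ->
  Rabs (grad (gam t) (dgam t) / (h (gam t) + c)) <= sqrt k * speed gam dgam t.
Proof.
move=> /WU [Ut hc]; rewrite -sqrt_mult_alt; last by lra.
rewrite -sqrt_Rsqr_abs; apply: sqrt_le_1_alt; rewrite Rsqr_pow2.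
exact: log_deriv_le k1 c0 hc (hess_bound _ Ut).
Qed.

(** Integrates [dlog_le_speed] from 0 to [t]. The length of the whole curve on the right gives one
    bound for all [t]. *)
Lemma log_lipschitz gam dgam t : C1_curve W gam dgam -> 0 <= t <= 1 ->
  Rabs (ln (h (gam t) + c) - ln (h (gam 0) + c)) <= sqrt k * RInt (speed gam dgam) 0 1.
Proof.
move=> hg t01.
have i0t : ex_RInt (speed gam dgam) 0 t by apply: ex_RInt_speed hg _ _; lra.
have it1 : ex_RInt (speed gam dgam) t 1 by apply: ex_RInt_speed hg _ _; lra.
pose f' s := grad (gam s) (dgam s) / (h (gam s) + c).
have I : is_RInt f' 0 t (ln (h (gam t) + c) - ln (h (gam 0) + c)).
  apply: (is_RInt_derive (fun s => ln (h (gam s) + c)));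
    rewrite Rmin_left ?Rmax_right; try lra; move=> s st; have s01 : 0 <= s <= 1 by lra.
    have [/WU [Us hc] _] := hg s s01.
    pose H u := h (gam u).
    have dh : is_derive H s (grad (gam s) (dgam s)) by exact: C1_curve_deriv_h (C1_curve_U hg) s01.
    change (is_derive (fun u => ln (H u + c)) s (f' s)).
    auto_derive; first by split; [eexists; exact: dh|split=> //; lra].
    by rewrite (is_derive_unique _ _ _ dh) /f' /H; field; lra.
  by apply/continuity_pt_filterlim; exact: C1_curve_continuity_dlog.
apply: (Rle_trans _ (sqrt k * RInt (speed gam dgam) 0 t)).
  apply: (norm_RInt_le f' (fun s => sqrt k * speed gam dgam s) 0 t _ _ _ _ I); first by lra.
    move=> s st; apply: dlog_le_speed; have s01 : 0 <= s <= 1 by lra.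
    by case: (hg s s01).
  by apply: is_RInt_scal; apply: RInt_correct.
apply: Rmult_le_compat_l; first exact: sqrt_pos.
rewrite -(RInt_Chasles _ 0 t 1) // /plus /=.
suff : 0 <= RInt (speed gam dgam) t 1 by lra.
by apply: RInt_ge_0 => // [|s _]; [lra | exact: sqrt_pos].
Qed.

End Shifted.

(** * Transfer of short curves between $g'$ and $g'_c$, and completeness *)

Lemma h_shift0_pos x : U x -> U x /\ 0 < h x + 0.
Proof. by move=> Ux; move: (hpos Ux); split=> //; lra. Qed.

(** The same curve serves, because $g' \le g'_c$ pointwise on $U_c$. *)
Lemma short_path_shift0 c x y eps : c <= 0 ->
  short_path (fun z => U z /\ 0 < h z + c) (fun z => ln (h z + c)) x y eps ->
  short_path U (fun z => ln (h z + 0)) x y eps.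
Proof.
move=> c0 /(short_pathP (fun z Wz => Wz)) [gam [dgam [g0 g1 hg len]]].
have hgU := C1_curve_U (fun z Wz => Wz) hg.
apply/(short_pathP h_shift0_pos); exists gam, dgam; split=> //.
apply: Rle_lt_trans len; apply: RInt_le; first by lra.
- by apply: (ex_RInt_speed h_shift0_pos hgU); lra.
- by apply: (ex_RInt_speed (fun z Wz => Wz) hg); lra.
move=> t t01; have [|[Ut hc] _] := hg t; first by lra.
apply: sqrt_le_1_alt; rewrite /log_metric Rplus_0_r.
exact: log_hessian_mono k1 c0 hc (hess_bound _ Ut).
Qed.

(* Along a curve where [h] stays above [m > -c], the two metrics are comparable,
   so the curve itself stays short after the shift. *)
Lemma short_path_shift c m d eps x y : c <= 0 -> 0 < m + c -> U x ->
  ln m + sqrt k * d <= ln (h x) -> sqrt k * (m / (m + c)) * d <= eps ->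
  short_path U (fun z => ln (h z + 0)) x y d ->
  (U y /\ 0 < h y + c) /\
  short_path (fun z => U z /\ 0 < h z + c) (fun z => ln (h z + c)) x y eps.
Proof.
move=> c0 mc Ux hx hd /(short_pathP h_shift0_pos) [gam [dgam [g0 g1 hg len]]].
have m0 : 0 < m by lra.
have sk : 0 < sqrt k by apply: sqrt_lt_R0; lra.
(* Along the curve $\log h$ drops by less than $\sqrt k\,d$, which the hypothesis on [ln (h x)]
   absorbs. *)
have hm t : 0 <= t <= 1 -> m <= h (gam t).
  move=> t01; have [Ut _] := hg t t01.
  have := log_lipschitz (Rle_refl 0) h_shift0_pos hg t01.
  rewrite !Rplus_0_r g0 => /Rabs_le_between [hl _].
  have : sqrt k * RInt (speed 0 gam dgam) 0 1 < sqrt k * d by exact: Rmult_lt_compat_l.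
  by move=> ?; apply: Rnot_lt_le => /(ln_increasing _ _ (hpos Ut)); lra.
have hgc : C1_curve (fun z => U z /\ 0 < h z + c) gam dgam.
  move=> t t01; have [Ut H] := hg t t01; have := hm t t01.
  by split=> //; split=> //; lra.
split; first by rewrite -g1; have [|] := hgc 1 => //; lra.
apply/(short_pathP (fun z Wz => Wz)); exists gam, dgam; split=> //.
apply: Rlt_le_trans hd.
have r0 : 0 < m / (m + c) by apply: Rdiv_lt_0_compat.
(* Square root of the constant in [log_hessian_le], since speeds rather than squared speeds are
   compared. *)
set r := sqrt k * (m / (m + c)).
have r1 : 0 < r by apply: Rmult_lt_0_compat.
apply: (Rle_lt_trans _ (r * RInt (speed 0 gam dgam) 0 1)); last exact: Rmult_lt_compat_l.
have i0 : ex_RInt (speed 0 gam dgam) 0 1 by apply: (ex_RInt_speed h_shift0_pos hg); lra.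
rewrite -[_ * _](RInt_scal (speed 0 gam dgam)) //; apply: RInt_le; first by lra.
- by apply: (ex_RInt_speed (fun z Wz => Wz) hgc); lra.
- exact: ex_RInt_scal.
move=> t t01; have t01' : 0 <= t <= 1 by lra.
have [Ut _] := hg t t01'.
rewrite /scal /= /mult /= /r -[m / (m + c)]sqrt_pow2; last by lra.
rewrite -!sqrt_mult_alt; try by (try apply: Rmult_le_pos; try lra; exact: pow2_ge_0).
apply: sqrt_le_1_alt; rewrite {2}/log_metric Rplus_0_r.
exact: log_hessian_le k1 c0 mc (hm t t01') (hess_bound _ Ut).
Qed.

Lemma log_metric_complete c : c < 0 ->
  hessian_metric_complete U (fun x => ln (h x)) ->
  hessian_metric_complete (fun x => U x /\ 0 < h x + c) (fun x => ln (h x + c)).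
Proof.
(* Presents $g'$ as the case [c = 0] of the shifted metrics. *)
have -> : (fun x => ln (h x)) = (fun x => ln (h x + 0)).
  by apply: functional_extensionality => x; rewrite Rplus_0_r.
move=> cn cplt u Wu cauchy; have c0 : c <= 0 by lra.
have sk : 0 < sqrt k by apply: sqrt_lt_R0; lra.
have [p [Up lim]] : exists p, U p /\ forall eps, 0 < eps -> exists N : nat, forall m : nat,
    (N <= m)%nat -> short_path U (fun x => ln (h x + 0)) (u m) p eps.
  apply: cplt => [m|eps /cauchy [N hN]]; first by case: (Wu m).
  by exists N => m l Nm Nl; apply: (short_path_shift0 c0); exact: hN.
have [N hN] := cauchy 1 Rlt_0_1.
have [UN hcN] := Wu N.
(* Beyond [N] the terms are within $g'_c$-distance 1 of [u N], so $\log(h+c)$ lies at most $\sqrt k$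
   below its value there. *)
pose e := exp (ln (h (u N) + c) - sqrt k).
have e0 : 0 < e by exact: exp_pos.
have low m : (N <= m)%N -> e - c <= h (u m).
  move=> /(hN _ _ (leqnn N)) /(short_pathP (fun z Wz => Wz)) [gam [dgam [g0 g1 hg len]]].
  have t01 : 0 <= 1 <= 1 by lra.
  have := log_lipschitz c0 (fun z Wz => Wz) hg t01.
  rewrite g0 g1 => /Rabs_le_between [hl _].
  have ? : sqrt k * RInt (speed c gam dgam) 0 1 < sqrt k * 1 by exact: Rmult_lt_compat_l.
  have [_ hcm] := Wu m.
  suff : e <= h (u m) + c by lra.
  by apply: Rnot_lt_le => /(ln_increasing _ _ hcm); rewrite /e ln_exp; lra.
(* A level strictly between $-c$ and the lower bound $e-c$ of [h] on the tail: curves starting there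
   may lose some height and still keep $h+c \ge e/2$. *)
pose m0 := e / 2 - c.
have m0c : 0 < m0 + c by rewrite /m0; lra.
have gap : 0 < ln (e - c) - ln m0.
  suff : ln m0 < ln (e - c) by lra.
  by apply: ln_increasing; rewrite /m0; lra.
have r0 : 0 < sqrt k * (m0 / (m0 + c)).
  by apply: Rmult_lt_0_compat => //; apply: Rdiv_lt_0_compat; rewrite /m0; lra.
have main eps : 0 < eps -> exists N : nat, forall m : nat, (N <= m)%N ->
    (U p /\ 0 < h p + c) /\
    short_path (fun z => U z /\ 0 < h z + c) (fun z => ln (h z + c)) (u m) p eps.
  (* The first entry keeps [h] above [m0] along the curve, the second makes its $g'_c$-length
     smaller than [eps]. *)
  move=> eps0; pose d := Rmin ((ln (e - c) - ln m0) / sqrt k) (eps / (sqrt k * (m0 / (m0 + c)))).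
  have d0 : 0 < d by apply: Rmin_glb_lt; apply: Rdiv_lt_0_compat.
  have [N' hN'] := lim d d0.
  (* [N] secures the lower bound [low], and [N'] the $g'$-closeness to [p]. *)
  exists (N + N')%N => m hm.
  have [Um _] := Wu m.
  apply: (short_path_shift c0 m0c Um _ _ (hN' m _)).
  - have /(Rmult_le_compat_l _ _ _ (Rlt_le _ _ sk)) : d <= (ln (e - c) - ln m0) / sqrt k by exact: Rmin_l.
    have -> : sqrt k * ((ln (e - c) - ln m0) / sqrt k) = ln (e - c) - ln m0 by field; lra.
    have : ln (e - c) <= ln (h (u m)) by apply: Rcomplements.ln_le; [lra | apply: low; exact: leq_trans (leq_addr _ _) hm].
    by lra.
  - have /(Rmult_le_compat_l _ _ _ (Rlt_le _ _ r0)) : d <= eps / (sqrt k * (m0 / (m0 + c))) by exact: Rmin_r.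
    have -> // : sqrt k * (m0 / (m0 + c)) * (eps / (sqrt k * (m0 / (m0 + c)))) = eps.
    by field; rewrite /m0; split; [lra|split; lra].
  - exact: leq_trans (leq_addl _ _) hm.
exists p; split.
  (* Any tolerance will do here: [p] lies in $U_c$ as the endpoint of one short curve. *)
  by have [N' H] := main 1 Rlt_0_1; have [] := H N' (leqnn N').
by move=> eps /main [N' H]; exists N' => m /H [].
Qed.

End LogHessian.

Theorem mainTheorem17 (n : nat) (U : vec n -> Prop) (h : vec n -> R) (k c : R) :
  is_domain U ->
  (forall t x, 0 < t -> U x -> U (vscal t x)) ->
  smooth_on U h ->
  (forall x, U x -> 0 < h x) ->
  1 < k ->
  (forall t x, 0 < t -> U x -> h (vscal t x) = Rpower t k * h x) ->
  (forall x v l, U x -> h x = 1 -> dderiv h x v 0 -> v <> vzero ->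
     dderiv2 h x v l -> 0 < - l) ->
  hessian_metric_complete U (fun x => ln (h x)) ->
  c < 0 ->
  hessian_metric_complete (fun x => U x /\ 0 < h x + c) (fun x => ln (h x + c)).
Proof.
move=> [oU _] cone [D [D0 [D1 Dc]]] hpos k1 hom neg cplt c0.
exact: (log_metric_complete oU cone D0 D1 Dc hpos k1 hom neg c0 cplt).
Qed.
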